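(* Let $(k_n)_{n\ge 0}$ be the sequence of positive integers with $k_0=1$ and $k_{n+1}=(2k_n)!$ for $n\ge 0$. Let $(x_i)_{i\ge 0}$ be the sequence of words over $\{0,1\}$ with $x_0=1$ and $x_{i+1}=x_ix_i0^{k_{i+1}-2k_i}$ for $i\ge 0$, and let $u=\lim_{i\to\infty}x_i$ be the infinite word having every $x_i$ as a prefix. Then: 1. the word $u$ is recurrent; 2. the word $u$ is not eventually periodic.
   Context: An infinite word $u=u_0u_1u_2\cdots$ is recurrent if every factor (finite block of consecutive letters) of $u$ appears infinitely many times in $u$. It is eventually periodic if $u=wvvv\cdots$ for some finite words $w$ and $v$, with $v$ non-empty. For a letter $x$, $x^m$ is the word made of $m$ copies of $x$. *)

(* Defs.v *)
From mathcomp Require Import all_boot.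
Set Implicit Arguments.
Unset Strict Implicit.
Unset Printing Implicit Defensive.

Section Words.
Variable T : Type.

(* Finite words are [seq T]; infinite words are functions [nat -> T]. *)
Implicit Types (w v : seq T) (u : nat -> T).

(* The block u_i u_(i+1) ... u_(i+n-1). *)
Definition block u (i n : nat) : seq T := mkseq (fun j => u (i + j)) n.

Definition occurs_at w u (i : nat) : Prop := block u i (size w) = w.

Definition factor w u : Prop := exists i, occurs_at w u i.

Definition iprefix w u : Prop := occurs_at w u 0.

(* A set of positions in nat is infinite iff it is unbounded. *)
Definition occurs_infinitely_often w u : Prop :=
  forall N, exists i, N <= i /\ occurs_at w u i.

Definition recurrent u : Prop :=
  forall w, factor w u -> occurs_infinitely_often w u.

Definition wpow w (m : nat) : seq T := flatten (nseq m w).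

(* For non-empty v, u = wvvv... says that every w v^m is a prefix of u. *)
Definition eventually_periodic u : Prop :=
  exists w v, 0 < size v /\ forall m, iprefix (w ++ wpow v m) u.

(* u = lim x_i for a sequence of words x, each a prefix of the next, whose
   lengths tend to infinity. *)
Definition limit_word (x : nat -> seq T) u : Prop := forall i, iprefix (x i) u.

End Words.

Fixpoint k_ (n : nat) : nat := if n is m.+1 then (2 * k_ m)`! else 1.

(* The letters 0 and 1 are [false] and [true]. The truncated subtraction is
   exact here, by [leq_double_k]. *)
Fixpoint x_ (i : nat) : seq bool :=
  if i is j.+1 then x_ j ++ x_ j ++ nseq (k_ j.+1 - 2 * k_ j) false
  else [:: true].

Lemma leq_double_k n : 2 * k_ n <= k_ n.+1.
Proof. exact: fact_geq. Qed.

Lemma size_x i : size (x_ i) = k_ i.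
Proof.
elim: i => // i IH; rewrite [x_ _]/= !size_cat size_nseq IH addnA addnn -mul2n.
by rewrite subnKC // leq_double_k.
Qed.

Lemma ltn_k i : i < k_ i.
Proof.
elim: i => // i IH; apply: leq_trans (leq_double_k i).
by rewrite mul2n -addnn -addn1 leq_add // (leq_ltn_trans _ IH).
Qed.

Lemma nth_x i j n : i <= j -> n < k_ i -> nth false (x_ j) n = nth false (x_ i) n.
Proof.
move=> le_ij lt_n; elim: j le_ij => [|j IH]; first by rewrite leqn0 => /eqP ->.
rewrite leq_eqVlt => /orP[/eqP -> //|]; rewrite ltnS => le_ij.
rewrite -(IH le_ij) [x_ _]/= nth_cat size_x ifT //.
apply: leq_trans lt_n _; elim: j le_ij {IH} => [|j IH].
  by rewrite leqn0 => /eqP ->.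
rewrite leq_eqVlt => /orP[/eqP -> //|/IH/leq_trans]; apply.
by apply: leq_trans (leq_double_k j); rewrite leq_pmull.
Qed.

Lemma limit_word_x_exists : exists u, limit_word x_ u.
Proof.
exists (fun n => nth false (x_ n) n) => i.
apply: (@eq_from_nth _ false); rewrite size_mkseq // => n lt_n.
rewrite nth_mkseq // add0n; rewrite size_x in lt_n.
by case: (leqP i n) => [/nth_x -> //|/ltnW/nth_x -> //]; apply: ltn_k.
Qed.

Lemma limit_word_x_unique u1 u2 : limit_word x_ u1 -> limit_word x_ u2 -> u1 =1 u2.
Proof.
have val u : limit_word x_ u -> forall n, u n = nth false (x_ n) n.
  by move=> lim n; rewrite -[in RHS](lim n) nth_mkseq ?size_x ?ltn_k.
by move=> /val lim1 /val lim2 n; rewrite lim1 lim2.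
Qed.

(* Main.v *)
Require Import Defs.
From mathcomp Require Import all_boot.
Set Implicit Arguments.
Unset Strict Implicit.
Unset Printing Implicit Defensive.

(** Recurrence: since [x_m x_m] is a prefix of [u] for every [m], a factor
    lying inside [x_m] occurs again [k_m] positions further.
    Aperiodicity: [u] has the letter 1 at position [k_m] and only 0s on
    [2 k_m, k_(m+1)).  If [p] were an eventual period, then for [m] large the
    position [k_m + k_m p] would carry the letter 1; but it lies in that run of
    0s as soon as [p < k_m], because [k_m ^ 2 < (2 k_m)! = k_(m+1)]. *)

Lemma iprefix_nth (T : Type) (x0 : T) (w : seq T) (u : nat -> T) n :
  iprefix w u -> n < size w -> u n = nth x0 w n.
Proof. by move=> pre lt_n; rewrite -[in RHS]pre nth_mkseq. Qed.

Lemma nth_cat_add (T : Type) (x0 : T) (s1 s2 : seq T) n :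
  nth x0 (s1 ++ s2) (size s1 + n) = nth x0 s2 n.
Proof. by rewrite nth_cat ltnNge leq_addr addKn. Qed.

(** The period is [size v]: past [w], dropping the first copy of [v] from [wpow v i.+2] leaves
    [wpow v i.+1]. *)
Lemma eventually_periodic_shift (T : Type) (u : nat -> T) :
  eventually_periodic u ->
  exists N p, 0 < p /\ forall t, N <= t -> u (t + p) = u t.
Proof.
move=> [w [v [v_gt0 pre]]]; exists (size w), (size v); split=> // t le_t.
rewrite -(subnKC le_t); set i := t - size w; pose x0 := u 0.
have size_pow m : size (wpow v m) = m * size v.
  by elim: m => // m IH; rewrite mulSn -IH -size_cat.
(* As [v] is non-empty, [i.+1] copies of it reach beyond offset [i]. *)
have lt_i : i < size (wpow v i.+1) by rewrite size_pow leq_pmulr.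
rewrite (iprefix_nth x0 (pre i.+2)); last first.
  by rewrite size_cat -addnA ltn_add2l size_pow mulSn addnC ltn_add2l -size_pow.
rewrite (iprefix_nth x0 (pre i.+1)); last by rewrite size_cat ltn_add2l.
have -> : wpow v i.+2 = v ++ wpow v i.+1 by [].
by rewrite -addnA !nth_cat_add addnC nth_cat_add.
Qed.

Lemma periodic_shift_mul (T : Type) (u : nat -> T) N p :
  (forall t, N <= t -> u (t + p) = u t) ->
  forall j t, N <= t -> u (t + j * p) = u t.
Proof.
move=> per; elim=> [|j IH] t le_t; first by rewrite addn0.
by rewrite mulSn addnA IH ?per // (leq_trans le_t) ?leq_addr.
Qed.

(** Split off the top factor: [(2k)! = 2k (2k-1)!], where [2k > k] and [(2k-1)! >= 2k-1 >= k]. *)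
Lemma ltn_sqr_fact_double k : 0 < k -> k * k < (2 * k)`!.
Proof.
case: k => // k _; rewrite [2 * _]mulnS factS.
apply: (@leq_trans ((2 + 2 * k) * k.+1)).
  by rewrite ltn_pmul2r // add2n !ltnS mul2n -addnn leq_addr.
rewrite leq_pmul2l //; apply: leq_trans (fact_geq _).
by rewrite ltnS mul2n -addnn leq_addr.
Qed.

Section LimitWord.

Context {u : nat -> bool} (hu : limit_word x_ u).

Lemma limit_word_nth m n : n < k_ m -> u n = nth false (x_ m) n.
Proof. by move=> lt_n; apply: iprefix_nth (hu m) _; rewrite size_x. Qed.

Lemma limit_word_repeat m t : t < k_ m -> u (k_ m + t) = u t.
Proof.
move=> lt_t.
have lt_kt : k_ m + t < k_ m.+1.
  by apply: leq_trans (leq_double_k m); rewrite mul2n -addnn ltn_add2l.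
rewrite (limit_word_nth lt_kt) (limit_word_nth lt_t) [x_ _]/=.
by rewrite -[in k_ m + t](size_x m) nth_cat_add nth_cat size_x lt_t.
Qed.

(** These positions are the padding that ends [x_ m.+1]. *)
Lemma limit_word_gap m t : 2 * k_ m <= t < k_ m.+1 -> u t = false.
Proof.
move=> /andP[ge_t lt_t]; rewrite (limit_word_nth lt_t) [x_ _]/= catA nth_cat.
rewrite size_cat size_x addnn -mul2n ltnNge ge_t /= nth_nseq.
by case: ifP.
Qed.

Lemma limit_word_k m : u (k_ m) = true.
Proof.
(* Position [k_ m] starts the second copy of [x_ m], so it repeats [u 0]. *)
rewrite -[k_ m]addn0 limit_word_repeat; last exact: leq_ltn_trans (ltn_k m).
by rewrite (@limit_word_nth 0).
Qed.

Lemma limit_word_recurrent : recurrent u.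
Proof.
(* Since [m < k_ m], this choice puts the new occurrence beyond [N] and the old one inside
   [x_ m]. *)
move=> w [i occ] N; set m := N + (i + size w); exists (k_ m + i).
have lt_m := ltn_k m; split.
  by apply: leq_trans (leq_addr _ _); apply: leq_trans (ltnW lt_m); apply: leq_addr.
rewrite /occurs_at -[RHS]occ; apply: (@eq_from_nth _ false).
  by rewrite !size_mkseq.
rewrite size_mkseq => j lt_j; rewrite !nth_mkseq // -addnA limit_word_repeat //.
apply: leq_trans (ltnW lt_m); apply: leq_trans (leq_addl _ _).
by rewrite ltn_add2l.
Qed.

Lemma limit_word_not_eventually_periodic : ~ eventually_periodic u.
Proof.
move=> /eventually_periodic_shift[N [p [p_gt0 per]]].
set m := N + p; have lt_m := ltn_k m.
have k_gt0 : 0 < k_ m by apply: leq_ltn_trans lt_m.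
have le_N : N <= k_ m by apply: leq_trans (ltnW lt_m); apply: leq_addr.
have lt_p : p < k_ m by apply: leq_ltn_trans lt_m; apply: leq_addl.
have := periodic_shift_mul per (k_ m) le_N.
(* The position is [k_ m * p.+1]: at least [2 * k_ m] as [p > 0], at most [k_ m * k_ m] as
   [p < k_ m]. *)
rewrite limit_word_k (@limit_word_gap m) // -mulnS; apply/andP; split.
  by rewrite mulnC leq_pmul2l.
by apply: leq_ltn_trans (ltn_sqr_fact_double k_gt0); rewrite leq_pmul2l.
Qed.

End LimitWord.

Theorem mainTheorem5 (u : nat -> bool) (hu : limit_word x_ u) :
  recurrent u /\ ~ eventually_periodic u.
Proof.
by split; [exact: limit_word_recurrent|exact: limit_word_not_eventually_periodic].
Qed.
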